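(* Let $G$ be a connected $k$-regular simple graph with $k\geq 2$ and $|V(G)|\geq 4$, and let $n\geq 3$ be an integer. Then \[ \lambda_3(G\times T_n)=\begin{cases}\min\{n^2\lambda_2(G),\,3nk-6\}, & \text{if } g(G)=3;\\ \min\{n^2\lambda_2(G),\,3nk-4\}, & \text{if } g(G)\geq 4.\end{cases} \]
   Context: The total graph $T_n$ is obtained from the complete graph $K_n$ by attaching a loop at every vertex. The direct product $G\times H$ has vertex set $V(G)\times V(H)$, with $(u_1,v_1)$ adjacent to $(u_2,v_2)$ iff $u_1u_2\in E(G)$ and $v_1v_2\in E(H)$ (for $H=T_n$, $v_1v_2\in E(H)$ holds for all $v_1,v_2$, including $v_1=v_2$, because of the loops). For a graph $X$ and integer $j\ge 1$, an edge set $S\subseteq E(X)$ is a $j$-restricted edge-cut if $X-S$ is disconnected and every component of $X-S$ has at least $j$ vertices; $\lambda_j(X)$ is the minimum size of a $j$-restricted edge-cut, or $+\infty$ if none exists. $g(G)$ denotes the girth of $G$. *)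

(* Defs.v *)
From mathcomp Require Import all_boot all_order all_algebra.
From mathcomp Require Import constructive_ereal.
Import Order.TTheory GRing.Theory Num.Theory.

Set Implicit Arguments.
Unset Strict Implicit.
Unset Printing Implicit Defensive.

Local Open Scope ring_scope.

(* A graph on V, possibly with loops, is a symmetric relation on V; it is
   simple when the relation is moreover irreflexive.  An edge is the set of its
   endpoints, so that a loop is a singleton. *)

Definition edges (V : finType) (e : rel V) : {set {set V}} :=
  [set [set p.1; p.2] | p : V * V & e p.1 p.2].

Definition del_edges (V : finType) (e : rel V) (S : {set {set V}}) : rel V :=
  [rel x y | e x y && ([set x; y] \notin S)].

Definition components (V : finType) (e : rel V) : {set {set V}} :=
  [set [set y | connect e x y] | x : V].

Definition connected (V : finType) (e : rel V) : bool :=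
  #|components e| == 1%N.

Definition disconnected (V : finType) (e : rel V) : bool :=
  (1 < #|components e|)%N.

Definition regular (V : finType) (e : rel V) (k : nat) : Prop :=
  forall x : V, #|[set y | e x y]| = k.

Definition complete_graph (n : nat) : rel 'I_n := [rel u v | u != v].

Definition total_graph (n : nat) : rel 'I_n :=
  [rel u v | complete_graph u v || (u == v)].

Definition direct_product (V W : finType) (e : rel V) (f : rel W) :
    rel (V * W)%type :=
  [rel p q | e p.1 q.1 && f p.2 q.2].

Definition restricted_edge_cut (V : finType) (e : rel V) (j : nat)
    (S : {set {set V}}) : bool :=
  [&& S \subset edges e,
      disconnected (del_edges e S) &
      [forall C in components (del_edges e S), (j <= #|C|)%N]].

(* The neutral element of the minimum makes this +oo if there is no such cut. *)
Definition lambda (j : nat) (V : finType) (e : rel V) : \bar int :=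
  \big[Order.min/+oo%E]_(S : {set {set V}} | restricted_edge_cut e j S)
    (#|S|%:Z)%:E.

Definition has_cycle (V : finType) (e : rel V) (m : nat) : bool :=
  (2 < m)%N && [exists c : m.-tuple V, ucycleb e c].

(* The vertices of a cycle are distinct, hence the bound #|V| on the length. *)
Definition girth (V : finType) (e : rel V) : \bar int :=
  \big[Order.min/+oo%E]_(m < #|V|.+1 | has_cycle e m) (m%:Z)%:E.

(* Main.v *)
(* A 3-restricted edge-cut contains the boundary of a vertex set A such that A
   and its complement both have at least 3 vertices.  Among these sets choose
   one whose boundary has minimum size and, subject to this, with the fewest
   vertices.  If A or its complement has exactly 3 vertices, counting degrees
   gives the bound 3nk - 6, or 3nk - 4 when there is no triangle.  Otherwise any
   single vertex may still be moved to the other side, so minimality forces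
   each vertex of A to have strictly more neighbours in A than outside, and each
   vertex outside to have at least as many neighbours outside as in A.  Vertices
   of the same fibre have the same neighbours, hence A is a union of fibres, and
   it is the lift of a vertex set of G whose boundary is 2-restricted. *)
Require Import Defs.
From mathcomp Require Import all_boot all_order all_algebra.
From mathcomp Require Import constructive_ereal.
From mathcomp Require Import zify.
Import Order.TTheory GRing.Theory Num.Theory.

Set Implicit Arguments.
Unset Strict Implicit.
Unset Printing Implicit Defensive.

(** * Boundaries of vertex sets and restricted edge-cuts *)

Section Cuts.

Variables (V : finType) (e : rel V).
Implicit Types (A : {set V}) (S : {set {set V}}) (x y z : V).

Definition boundary A : {set {set V}} :=
  [set [set p.1; p.2] | p : V * V & [&& p.1 \in A, p.2 \notin A & e p.1 p.2]].

(** A sum of booleans, rather than a cardinal, lets double sums be exchanged and split. *)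
Definition deg_in A x : nat := \sum_(y in A) e x y.

Definition cut_size A : nat := \sum_(x in A) deg_in (~: A) x.

(** Pairs are oriented from [A] outwards, so an edge determines its pair and is counted once. *)
Lemma card_boundary A : #|boundary A| = cut_size A.
Proof.
rewrite /boundary card_in_imset => [|[x y] [x' y']]; last first.
  rewrite !inE /= => /and3P[xA yA _] /and3P[x'A y'A _] E.
  have := set21 x y; rewrite E !inE => /orP[]/eqP Ex; last by rewrite -Ex xA in y'A.
  have := set22 x y; rewrite E !inE => /orP[]/eqP Ey; first by rewrite Ey x'A in yA.
  by rewrite Ex Ey.
rewrite -sum1_card /cut_size /deg_in.
rewrite (eq_bigl (fun p : V * V => (p.1 \in A) && ((p.2 \in ~: A) && e p.1 p.2))); last first.
  by move=> p; rewrite !inE.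
rewrite -(pair_big_dep (fun x => x \in A) (fun x y => (y \in ~: A) && e x y) (fun _ _ => 1)) /=.
by apply: eq_bigr => x _; rewrite big_mkcondr; apply: eq_bigr => y _; case: (e x y).
Qed.

Lemma deg_in_card A x : deg_in A x = #|[set y in A | e x y]|.
Proof.
rewrite /deg_in -sum1dep_card big_mkcondr.
by apply: eq_bigr => y _; case: (e x y).
Qed.

Lemma deg_in_setC A x : deg_in A x + deg_in (~: A) x = #|[set y | e x y]|.
Proof.
rewrite !deg_in_card -(cardsID A [set y | e x y]).
by congr (_ + _); apply: eq_card => y; rewrite !inE // andbC.
Qed.

Lemma deg_in_gt0P A x : reflect (exists2 y, y \in A & e x y) (0 < deg_in A x).
Proof.
rewrite deg_in_card; apply: (iffP card_gt0P) => [[y]|[y yA xy]].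
  by rewrite inE => /andP[]; exists y.
by exists y; rewrite inE yA.
Qed.

Lemma del_boundary x y A : symmetric e ->
  del_edges e (boundary A) x y = e x y && ((x \in A) == (y \in A)).
Proof.
move=> e_sym; rewrite /del_edges /=; case exy: (e x y) => //=.
apply/idP/idP => [|/eqP xy]; last first.
  apply/imsetP=> -[[u v]]; rewrite inE /= => /and3P[uA vA _] E.
  have := set21 u v; have := set22 u v; rewrite -E !inE.
  by case/orP=> /eqP Ev /orP[] /eqP Eu; move: vA; rewrite Ev ?xy -?Eu ?uA // -?xy -?Eu ?uA // xy -Eu uA.
apply: contraR => xy; apply/imsetP.
have [xA|xA] := boolP (x \in A).
  by exists (x, y); rewrite // inE /= xA exy andbT; move: xy; rewrite xA; case: (y \in A).
exists (y, x); last by rewrite /= setUC.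
by rewrite inE /= xA e_sym exy andbT; move: xy; rewrite (negPf xA); case: (y \in A).
Qed.

(** [A] is closed under the surviving adjacency, so a vertex of [A] and one outside it lie in
    different components. *)
Lemma boundary_restricted j A : symmetric e -> A != set0 -> ~: A != set0 ->
    (forall x, j <= #|[set y | connect (del_edges e (boundary A)) x y]|) ->
  restricted_edge_cut e j (boundary A).
Proof.
move=> e_sym /set0Pn[x xA] /set0Pn[y yA] hj; apply/and3P; split.
- apply/subsetP=> E /imsetP[p]; rewrite inE => /and3P[_ _ ep] ->.
  by apply/imsetP; exists p; rewrite ?inE.
- apply/card_gt1P.
  exists [set z | connect (del_edges e (boundary A)) x z].
  exists [set z | connect (del_edges e (boundary A)) y z].
  split; try exact: imset_f.
  apply/eqP=> /setP/(_ y); rewrite !inE connect0.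
  have cl : closed (del_edges e (boundary A)) (mem A).
    by move=> u v; rewrite /= del_boundary // => /andP[_ /eqP].
  by move/(closed_connect cl); rewrite xA; move: yA; rewrite inE => /negPf->.
- by apply/forallP=> C; apply/implyP=> /imsetP[z _ ->].
Qed.

(** When [e] is simple and both sides are nonempty, this makes the boundary of [A] 2-restricted. *)
Definition no_isolated A : Prop :=
  forall x, exists2 y, e x y & (x \in A) = (y \in A).

(** Take for [A] one component of the graph left by [S]: every edge leaving it is in [S], and its
    complement contains another component. *)
Lemma restricted_boundary j S : symmetric e -> restricted_edge_cut e j S ->
  exists A, [/\ boundary A \subset S, j <= #|A|, j <= #|~: A| & 1 < j -> no_isolated A].
Proof.
move=> e_sym /and3P[_ /card_gt1P[C [D [/imsetP[x _ ->] /imsetP[y _ ->] CD]]] /forallP hj].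
set e' := del_edges e S in CD hj *.
have e'_sym : symmetric e' by move=> u v; rewrite /e' /del_edges /= e_sym setUC.
have cs := sym_connect_sym e'_sym.
have hc z : j <= #|[set t | connect e' z t]|.
  by move/implyP: (hj [set t | connect e' z t]); apply; apply: imset_f.
have xy : ~~ connect e' x y.
  apply: contraNN CD => xy; apply/eqP/setP=> z; rewrite !inE.
  exact: same_connect.
exists [set z | connect e' x z]; split=> //.
- apply/subsetP=> E /imsetP[[u v]]; rewrite !inE /= => /and3P[xu xv uv] ->.
  apply: contraNT xv => uvS; apply: connect_trans xu (connect1 _).
  by rewrite /e' /del_edges /= uv.
- apply: leq_trans (hc y) (subset_leq_card _); apply/subsetP=> z; rewrite !inE => yz.
  by apply: contraNN xy => xz; apply: connect_trans xz _; rewrite cs.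
(* The component of [z] has a second vertex [t]; the first edge of a path from [z] to [t] gives a
   neighbour on the same side. *)
- move=> j1 z; have [t] : exists2 t, connect e' z t & t != z.
    have /card_gt1P[a [b []]] := leq_trans j1 (hc z); rewrite !inE => za zb ab.
    by have [Ea|az] := eqVneq a z; [exists b; rewrite // -Ea eq_sym|exists a].
  case/connectP=> -[|w p] /= pth ->; first by rewrite eqxx.
  move=> _; case/andP: pth => zw _; exists w; first by case/andP: zw.
  by rewrite !inE; apply: same_connect_r => //; apply: connect1.
Qed.

Lemma boundary_restricted2 A : symmetric e -> A != set0 -> ~: A != set0 ->
  no_isolated A -> irreflexive e -> restricted_edge_cut e 2 (boundary A).
Proof.
move=> e_sym A0 AT hA e_irr; apply: boundary_restricted => // x.
have [y xy xyA] := hA x; apply/card_gt1P; exists x, y; split.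
- by rewrite inE connect0.
- by rewrite inE connect1 // del_boundary // xy xyA eqxx.
by apply: contraTneq xy => ->; rewrite e_irr.
Qed.

Lemma cut_sizeC A : symmetric e -> cut_size (~: A) = cut_size A.
Proof.
move=> e_sym; rewrite /cut_size /deg_in setCK exchange_big /=.
by apply: eq_bigr => x _; apply: eq_bigr => y _; rewrite e_sym.
Qed.

(** Moving [x] out of [A] trades its outer edges for its inner ones; the additive form avoids
    truncated subtraction. *)
Lemma cut_sizeD1 A x : symmetric e -> irreflexive e -> x \in A ->
  cut_size (A :\ x) + deg_in (~: A) x = cut_size A + deg_in A x.
Proof.
move=> e_sym e_irr xA.
have -> : deg_in A x = deg_in (A :\ x) x.
  by rewrite /deg_in (big_setD1 x) //= e_irr.
rewrite /cut_size [in RHS](big_setD1 x) //= addnC -addnA {2}/deg_in; congr (_ + _); rewrite -big_split /=.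
apply: eq_bigr => y yA; rewrite /deg_in setCD setUC big_setU1 ?inE ?xA //=.
by rewrite addnC e_sym.
Qed.

Lemma cut_sizeU1 A x : symmetric e -> irreflexive e -> x \notin A ->
  cut_size (x |: A) + deg_in A x = cut_size A + deg_in (~: A) x.
Proof.
move=> e_sym e_irr xA; rewrite -(cut_sizeC A) // -(cut_sizeC (x |: A)) //.
rewrite -[in deg_in A x](setCK A) -cut_sizeD1 ?inE //.
by congr (cut_size _ + _); apply/setP=> y; rewrite !inE negb_or.
Qed.

Lemma cut_size_regular r A : regular e r ->
  cut_size A + \sum_(x in A) deg_in A x = r * #|A|.
Proof.
move=> e_reg; rewrite -big_split /= mulnC -sum_nat_const.
by apply: eq_bigr => x _; rewrite addnC deg_in_setC e_reg.
Qed.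

(** The degree sum [3 * r] counts boundary edges once and inner edges twice. *)
Lemma cut_size3 r x y z : symmetric e -> irreflexive e -> regular e r ->
    x != y -> x != z -> y != z ->
  cut_size [set x; y; z] + 2 * (e x y + e x z + e y z) = 3 * r.
Proof.
move=> e_sym e_irr e_reg xy xz yz.
have E (F : V -> nat) : \sum_(t in [set x; y; z]) F t = F x + F y + F z.
  rewrite -setUA big_setU1 ?inE ?negb_or ?xy //= big_setU1 ?inE //= big_set1.
  by rewrite addnA.
have := cut_size_regular [set x; y; z] e_reg.
rewrite -[#|_|]sum1_card E /deg_in !E !e_irr (e_sym y x) (e_sym z x) (e_sym z y).
lia.
Qed.

(** The triple is connected through [x]. Any vertex has at most 3 neighbours in it, hence at least 2
    outside, so an outer vertex keeps a component of at least 3 vertices. *)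
Lemma boundary_restricted3 r x y z : symmetric e -> irreflexive e ->
    regular e r -> 5 <= r -> e x y -> e x z -> y != z ->
  restricted_edge_cut e 3 (boundary [set x; y; z]).
Proof.
move=> e_sym e_irr e_reg r5 exy exz yz.
have xy : x != y by apply: contraTneq exy => ->; rewrite e_irr.
have xz : x != z by apply: contraTneq exz => ->; rewrite e_irr.
set A := [set x; y; z].
have cA : #|A| = 3 by rewrite /A -setUA cardsU1 cards2 !inE negb_or xy xz yz.
have out u : 2 <= deg_in (~: A) u.
  have := deg_in_setC A u; rewrite e_reg.
  have : deg_in A u <= 3.
    rewrite deg_in_card -cA; apply: subset_leq_card.
    by apply/subsetP=> v; rewrite inE => /andP[].
  lia.
have cs : connect_sym (del_edges e (boundary A)).
  by apply: sym_connect_sym => u v; rewrite /del_edges /= e_sym setUC.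
apply: boundary_restricted => //.
- by rewrite -card_gt0 cA.
- have /deg_in_gt0P[u uA _] : 0 < deg_in (~: A) x by apply: leq_trans (out x).
  by apply/set0Pn; exists u.
move=> u; have [uA|uA] := boolP (u \in A).
  have cx v : v \in A -> connect (del_edges e (boundary A)) x v.
    rewrite !inE -orbA => /or3P[] /eqP->; first exact: connect0.
      by apply: connect1; rewrite del_boundary // exy !inE !eqxx ?orbT.
    by apply: connect1; rewrite del_boundary // exz !inE !eqxx ?orbT.
  rewrite -cA; apply: subset_leq_card; apply/subsetP=> v vA; rewrite inE.
  by apply: connect_trans (cx v vA); rewrite cs cx.
apply: (@leq_trans #|u |: [set v in ~: A | e u v]|).
  by rewrite cardsU1 inE e_irr andbF -deg_in_card ltnS out.
apply: subset_leq_card; apply/subsetP=> v.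
rewrite in_setU1 inE in_setC inE => /orP[/eqP->|]; first exact: connect0.
by case/andP=> vA uv; apply: connect1; rewrite del_boundary // uv (negPf uA) (negPf vA).
Qed.

(** Moving a vertex out of [B] lowers the cardinal, so it must strictly raise the cut; moving one in
    raises the cardinal, so the cut need only not drop. Hence one inequality is strict and the other
    weak. *)
Lemma minimal_cut j A : symmetric e -> irreflexive e ->
    j <= #|A| -> j <= #|~: A| ->
  exists B, [/\ cut_size B <= cut_size A, j <= #|B|, j <= #|~: B| &
    [\/ #|B| = j, #|~: B| = j |
        (forall x, x \in B -> deg_in (~: B) x < deg_in B x) /\
        (forall x, x \notin B -> deg_in B x <= deg_in (~: B) x)]].
Proof.
move=> e_sym e_irr jA jAC.
pose P (B : {set V}) := (j <= #|B|) && (j <= #|~: B|).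
(* The weight encodes the lexicographic order on (cut_size B, #|B|). *)
pose m (B : {set V}) := cut_size B * #|V|.+1 + #|B|.
have PA : P A by rewrite /P jA.
have [B /andP[jB jBC] minB] := @arg_minnP _ A P m PA.
exists B; have leV D : #|D| <= #|V| := max_card D.
have cBA : cut_size B <= cut_size A.
  have := minB A PA; rewrite /m; have := leV A; have := leV B; nia.
split=> //.
have [/eqP|Bj] := boolP (#|B| == j); first by constructor 1.
have [/eqP|BCj] := boolP (#|~: B| == j); first by constructor 2.
constructor 3; split=> x xB.
  have sz := cardsD1 x B; rewrite xB in sz.
  have szC : #|~: (B :\ x)| = #|~: B|.+1.
    have := cardsC B; have := cardsC (B :\ x); lia.
  have /minB : P (B :\ x) by rewrite /P; lia.
  have := cut_sizeD1 e_sym e_irr xB; rewrite /m; have := leV B; nia.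
have sz : #|x |: B| = #|B|.+1 by rewrite cardsU1 xB.
have szC : #|~: B| = #|~: (x |: B)|.+1.
  have := cardsC B; have := cardsC (x |: B); lia.
have /minB : P (x |: B) by rewrite /P; lia.
have := cut_sizeU1 e_sym e_irr xB; rewrite /m; have := leV (x |: B); nia.
Qed.

(** Three vertices span at most 2 edges, or 3 when they form a triangle, which forces [t] to be
    positive; so twice the inner edges is at most [4 + 2 * t]. *)
Lemma card3_cut_ge r t A : symmetric e -> irreflexive e -> regular e r ->
    (forall x y z, e x y -> e x z -> e y z -> 0 < t) -> #|A| = 3 ->
  3 * r <= cut_size A + 4 + 2 * t.
Proof.
move=> e_sym e_irr e_reg tri cA.
have /card_gt2P[x [y [z [[xA yA zA] [xy yz zx]]]]] : 2 < #|A| by rewrite cA.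
have xz : x != z by rewrite eq_sym.
have <- : [set x; y; z] = A.
  apply/eqP; rewrite eqEcard -setUA !subUset !sub1set xA yA zA cA.
  by rewrite cardsU1 cards2 !inE negb_or xy xz yz.
have := cut_size3 e_sym e_irr e_reg xy xz yz.
by have := tri x y z; case: (e x y); case: (e x z); case: (e y z) => H; move: H; lia.
Qed.

End Cuts.

(** * The direct product with a total graph *)

Section Product.

Variables (V : finType) (e : rel V) (k n : nat).
Hypotheses (e_sym : symmetric e) (e_irr : irreflexive e) (e_reg : regular e k).

Let X := direct_product e (@total_graph n).

(** Thanks to the loops any two labels are adjacent, so all vertices of a fibre have the same
    neighbours. *)
Lemma productE p q : X p q = e p.1 q.1.
Proof. by rewrite /X /direct_product /total_graph /complete_graph /= orNb andbT. Qed.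

Lemma product_sym : symmetric X.
Proof. by move=> p q; rewrite !productE e_sym. Qed.

Lemma product_irr : irreflexive X.
Proof. by move=> p; rewrite productE e_irr. Qed.

Lemma deg_in_product (B : {set V}) p : deg_in X (setX B [set: 'I_n]) p = n * deg_in e B p.1.
Proof.
rewrite !deg_in_card.
transitivity #|setX [set y in B | e p.1 y] [set: 'I_n]|.
  by apply: eq_card => q; rewrite !inE productE !andbT.
by rewrite cardsX cardsT card_ord mulnC.
Qed.

Lemma product_reg : regular X (n * k).
Proof.
move=> p; have := deg_in_product setT p; rewrite !deg_in_card.
have -> : [set y in setT | e p.1 y] = [set y | e p.1 y].
  by apply/setP=> y; rewrite !inE.
by rewrite e_reg => <-; apply: eq_card => q; rewrite !inE.
Qed.

Lemma setCX_setT (A : {set V}) : ~: setX A [set: 'I_n] = setX (~: A) [set: 'I_n].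
Proof. by apply/setP=> p; rewrite !inE !andbT. Qed.

(** Each boundary edge of [A] lifts to [n ^ 2] edges, with [n] labels free at either end. *)
Lemma cut_size_product (A : {set V}) : cut_size X (setX A [set: 'I_n]) = n ^ 2 * cut_size e A.
Proof.
rewrite /cut_size setCX_setT.
rewrite (eq_bigl (fun p : V * 'I_n => (p.1 \in A) && true)); last first.
  by move=> p; rewrite !inE.
under eq_bigr do rewrite deg_in_product.
rewrite -(pair_big (fun x => x \in A) predT (fun x _ => n * deg_in e (~: A) x)) /=.
rewrite big_distrr /=; apply: eq_bigr => x _.
by rewrite sum_nat_const card_ord mulnA.
Qed.

(** A neighbour [y] of [x] on the same side puts the whole fibre of [y], of [n >= 3] vertices, in
    the component of [(x, i)]. *)
Lemma lifted_cut (A : {set V}) : 3 <= n -> A != set0 -> ~: A != set0 ->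
  no_isolated e A -> restricted_edge_cut X 3 (boundary X (setX A [set: 'I_n])).
Proof.
move=> n3 /set0Pn[a aA] /set0Pn[b bA] hA.
have n0 : 0 < n by lia.
apply: boundary_restricted; first exact: product_sym.
- by apply/set0Pn; exists (a, Ordinal n0); rewrite !inE aA.
- by rewrite setCX_setT; apply/set0Pn; exists (b, Ordinal n0); rewrite in_setX bA inE.
case=> x i; have [y xy xyA] := hA x; apply: leq_trans n3 _.
apply: (@leq_trans #|[set (y, j) | j : 'I_n]|).
  by rewrite card_imset ?card_ord // => ? ? [].
apply: subset_leq_card; apply/subsetP=> _ /imsetP[j _ ->].
by rewrite inE connect1 // del_boundary ?productE ?xy ?inE ?xyA ?eqxx //; exact: product_sym.
Qed.

Lemma product_cut_ge t (A : {set V * 'I_n}) : 0 < n -> 0 < k ->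
    (forall x y z, e x y -> e x z -> e y z -> 0 < t) ->
    3 <= #|A| -> 3 <= #|~: A| ->
  (exists A', [/\ A' != set0, ~: A' != set0, no_isolated e A' &
     n ^ 2 * cut_size e A' <= cut_size X A]) \/
  3 * (n * k) <= cut_size X A + 4 + 2 * t.
Proof.
move=> n0 k0 tri A3 AC3.
have triX p q r : X p q -> X p r -> X q r -> 0 < t.
  by rewrite !productE; apply: tri.
have small (B : {set V * 'I_n}) : #|B| = 3 -> 3 * (n * k) <= cut_size X B + 4 + 2 * t.
  exact: (card3_cut_ge product_sym product_irr product_reg triX).
have [B [BA B3 BC3]] := minimal_cut product_sym product_irr A3 AC3.
case=> [/small||[hB hBC]]; first by right; lia.
  by move=> /small; rewrite cut_sizeC; [right; lia|exact: product_sym].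
(* Testing label 0 suffices: vertices of one fibre have equal degrees into [B] and into its
   complement, so the strict and the weak inequality cannot both occur in a fibre. *)
left; pose A' := [set x | (x, Ordinal n0) \in B].
have fibre x i j : (x, i) \in B -> (x, j) \in B.
  move=> /hB xi; apply/negPn/negP => /hBC.
  have E D : deg_in X D (x, j) = deg_in X D (x, i).
    by apply: eq_bigr => q _; rewrite !productE.
  by rewrite !E leqNgt xi.
have BE : B = setX A' setT.
  by apply/setP=> -[x i]; rewrite !inE andbT; apply/idP/idP; apply: fibre.
exists A'; split.
- by apply: contraTneq B3 => A0; rewrite BE A0 cardsX cards0 mul0n.
- by apply: contraTneq BC3 => A0; rewrite BE setCX_setT A0 cardsX cards0 mul0n.
(* A vertex of [B] has an inner neighbour by strictness; a vertex outside has at least half of its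
   [n * k > 0] neighbours outside. *)
- move=> x; have := deg_in_setC X B (x, Ordinal n0); rewrite product_reg => D.
  have [xA|xA] := boolP (x \in A').
    have := hB (x, Ordinal n0); rewrite inE in xA; rewrite xA => /(_ isT) lt.
    have /deg_in_gt0P[[y j]] : 0 < deg_in X B (x, Ordinal n0) by lia.
    rewrite productE /= => yB xy; exists y => //.
    by rewrite inE (fibre _ _ _ yB).
  have := hBC (x, Ordinal n0); rewrite inE in xA => /(_ xA) le.
  have /deg_in_gt0P[[y j]] : 0 < deg_in X (~: B) (x, Ordinal n0) by nia.
  rewrite productE /= => yB xy; exists y => //.
  rewrite inE; apply/esym/negbTE; move: yB; rewrite inE; apply: contra.
  exact: fibre.
- by rewrite -cut_size_product -BE.
Qed.

End Product.

Local Open Scope ring_scope.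

(** * Restricted edge-connectivity as an attained minimum *)

Section Lambda.

Variables (V : finType) (e : rel V) (j : nat).

Lemma lambda_le (S : {set {set V}}) (m : nat) :
  restricted_edge_cut e j S -> (#|S| <= m)%N -> (lambda j e <= (m%:Z)%:E)%E.
Proof.
move=> cutS Sm; apply: (@bigmin_inf _ _ _ _ S) => //.
Qed.

Lemma lambda_ge (x : \bar int) :
    (forall S : {set {set V}}, restricted_edge_cut e j S -> (x <= (#|S|%:Z)%:E)%E) ->
  (x <= lambda j e)%E.
Proof. by move=> hx; apply: le_bigmin => //; rewrite leey. Qed.

Lemma lambda_attained : lambda j e = +oo%E \/
  exists2 S : {set {set V}}, restricted_edge_cut e j S & lambda j e = (#|S|%:Z)%:E.
Proof.
have [S0 cut0|none] := pickP (restricted_edge_cut e j).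
  right; have [S] := eq_bigmin S0 (restricted_edge_cut e j)
    (fun S : {set {set V}} => (#|S|%:Z)%:E) cut0 (fun S _ => leey _).
  by exists S.
by left; rewrite /lambda big_pred0.
Qed.

End Lambda.

(** * Triangles and girth *)

Lemma has_cycle3P (V : finType) (e : rel V) : symmetric e -> irreflexive e ->
  reflect (exists x y z, [/\ e x y, e x z & e y z]) (has_cycle e 3).
Proof.
move=> e_sym e_irr; rewrite /has_cycle /=; apply: (iffP existsP).
  case=> -[[|x [|y [|z [|//]]]] //= sz]; rewrite /ucycleb /= => /andP[+ _].
  by case/and4P=> xy yz zx _; exists x, y, z; rewrite xy yz e_sym zx.
have ne a b : e a b -> a != b by apply: contraTneq => ->; rewrite e_irr.
move=> [x [y [z [xy xz yz]]]]; exists [tuple x; y; z].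
by rewrite /ucycleb /= xy yz e_sym xz !inE negb_or !ne.
Qed.

(** A finite value cannot be the default [+oo], so some cycle length attains it. *)
Lemma girth_attained (V : finType) (e : rel V) (m : nat) :
  girth e = (m%:Z)%:E -> has_cycle e m.
Proof.
have [i0 cyc0|none] := pickP (fun m : 'I_#|V|.+1 => has_cycle e m); last first.
  by rewrite /girth big_pred0.
have [i ci Ei] := eq_bigmin i0 (fun m : 'I_#|V|.+1 => has_cycle e m)
  (fun m : 'I_#|V|.+1 => ((m : nat)%:Z)%:E) cyc0 (fun m _ => leey _).
by rewrite /girth Ei => -[<-].
Qed.

Lemma girth_le (V : finType) (e : rel V) (m : nat) :
  (m <= #|V|)%N -> has_cycle e m -> (girth e <= (m%:Z)%:E)%E.
Proof.
move=> mV cyc; have mV1 : (m < #|V|.+1)%N by [].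
exact: (@bigmin_inf _ _ _ _ (Ordinal mV1)).
Qed.

(** * The value of the 3-restricted edge-connectivity *)

(* The vertices q, p, r form the path, or the triangle when t = 1, that realises
   the degree bound. *)
Lemma lambda3_product (V : finType) (e : rel V) (k n t : nat) (p q r : V * 'I_n) :
    symmetric e -> irreflexive e -> regular e k -> (2 <= k)%N -> (3 <= n)%N ->
    e p.1 q.1 -> e p.1 r.1 -> q != r -> (t <= e q.1 r.1)%N ->
    (forall x y z, e x y -> e x z -> e y z -> (0 < t)%N) ->
  lambda 3 (direct_product e (@total_graph n)) =
    Order.min ((n%:Z ^+ 2)%:E * lambda 2 e)%E
              ((3 * n * k - (4 + 2 * t))%N%:Z)%:E.
Proof.
move=> e_sym e_irr e_reg k2 n3 pq pr qr tqr tri.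
set X := direct_product _ _.
have X_sym : symmetric X by exact: product_sym.
have X_irr : irreflexive X by exact: product_irr.
have X_reg : regular X (n * k) by exact: product_reg.
apply/eqP; rewrite eq_le; apply/andP; split; last first.
  (* Lower bound: a boundary inside [S] is compared with one of the two terms of the minimum. *)
  apply: lambda_ge => S /(restricted_boundary X_sym)[A [AS A3 AC3 _]].
  have cutS : (cut_size X A <= #|S|)%N.
    by rewrite -card_boundary ?subset_leq_card.
  rewrite ge_min; apply/orP.
  have n0 : (0 < n)%N by lia.
  have k0 : (0 < k)%N by lia.
  have := product_cut_ge e_sym e_irr e_reg n0 k0 tri A3 AC3; rewrite -/X.
  case=> [[A' [A0 AC0 hA' le]]|le]; [left|right]; last first.
    by rewrite lee_fin lez_nat; lia.
  apply: (@le_trans _ _ ((n%:Z ^+ 2)%:E * ((cut_size e A')%:Z)%:E)%E).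
    apply: lee_wpmul2l; first by rewrite lee_fin exprn_ge0.
    apply: lambda_le (boundary_restricted2 e_sym A0 AC0 hA' e_irr) _.
    by rewrite card_boundary.
  by rewrite -EFinM lee_fin; nia.
rewrite le_min; apply/andP; split.
  have [->|[S cutS ->]] := lambda_attained e 2.
    (* Without a 2-restricted cut the first term is [+oo], since [n ^ 2] is positive. *)
    by rewrite gt0_muley ?leey // lte_fin exprn_gt0 // ltz_nat; lia.
  have [A [AS A2 AC2 hA]] := restricted_boundary e_sym cutS.
  have A0 : A != set0 by rewrite -card_gt0; lia.
  have AC0 : ~: A != set0 by rewrite -card_gt0; lia.
  have := lambda_le (lifted_cut e_sym n3 A0 AC0 (hA isT)) (leqnn _).
  move/le_trans; apply; rewrite card_boundary cut_size_product -card_boundary.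
  rewrite -EFinM lee_fin; have := subset_leq_card AS; nia.
have Xpq : X p q by rewrite /X productE.
have Xpr : X p r by rewrite /X productE.
have ne a b : X a b -> a != b by apply: contraTneq => ->; rewrite X_irr.
(* The degree [n * k] is at least 6, so the boundary of the triple is a valid cut. *)
have := boundary_restricted3 X_sym X_irr X_reg _ Xpq Xpr qr.
move=> cutS; apply: (lambda_le (cutS _)); first by nia.
rewrite card_boundary.
have := cut_size3 X_sym X_irr X_reg (ne _ _ Xpq) (ne _ _ Xpr) qr.
rewrite Xpq Xpr (productE e q r : X q r = _) mulnA /=; lia.
Qed.

Theorem theorem3p3 (V : finType) (e : rel V) (k n : nat)
    (e_sym : symmetric e) (e_irr : irreflexive e)
    (e_conn : connected e) (e_reg : regular e k)
    (k_ge2 : (2 <= k)%N) (V_ge4 : (4 <= #|V|)%N) (n_ge3 : (3 <= n)%N) :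
  (girth e = 3%:Z%:E ->
     lambda 3 (direct_product e (@total_graph n)) =
       Order.min ((n%:Z ^+ 2)%:E * lambda 2 e)%E
                 (3 * n%:Z * k%:Z - 6)%:E)
  /\
  ((4%:Z%:E <= girth e)%E ->
     lambda 3 (direct_product e (@total_graph n)) =
       Order.min ((n%:Z ^+ 2)%:E * lambda 2 e)%E
                 (3 * n%:Z * k%:Z - 4)%:E).
Proof.
have n0 : (0 < n)%N by lia.
have n1 : (1 < n)%N by lia.
have cycP := has_cycle3P e_sym e_irr.
split=> g.
  have /cycP[x [y [z [xy xz yz]]]] := girth_attained g.
  pose i := Ordinal n0.
  (* A triangle of [e] is copied into a single layer. *)
  rewrite (@lambda3_product _ e k n 1 (x, i) (y, i) (z, i)) //=.
  (* The natural subtraction agrees with the integer one because [3 * n * k] is at least 18. *)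
  - by congr (Order.min _ (_%:E)); nia.
  - by apply: contraTneq yz => - [->]; rewrite e_irr.
  - by rewrite yz.
have /card_gt0P[x _] : (0 < #|V|)%N by lia.
have /card_gt0P[y] : (0 < #|[set y | e x y]|)%N by rewrite e_reg; lia.
rewrite inE => xy.
(* A single edge of [e] suffices for the path: its two ends are distinct vertices in the fibre of
   [y]. *)
rewrite (@lambda3_product _ e k n 0 (x, Ordinal n0) (y, Ordinal n0) (y, Ordinal n1)) //=.
- by congr (Order.min _ (_%:E)); nia.
- by rewrite xpair_eqE eqxx.
move=> a b c ab ac bc; have cyc : has_cycle e 3 by apply/cycP; exists a, b, c.
have := le_trans g (girth_le (ltnW V_ge4) cyc).
by rewrite lee_fin.
Qed.
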